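(* Let $\mathcal{G}$ be a circular planar network with $n$ nodes and response matrix $L$. If each of the $\binom{n}{2}$ small central minors of $L$ is positive, then $\mathcal{G}$ is well-connected.
   Context: A circular planar network is a finite graph $\mathcal{G}=(V,E)$ embedded in the plane, with a distinguished set $\mathcal{N}=\{1,\dots,n\}\subset V$ of vertices, called nodes, on the outer face, labelled in cyclic order, and a positive conductance $c(e)>0$ on each edge. Every connected component contains at least one node. The Laplacian is $\Delta f(v)=\sum_{v'}c_{v,v'}(f(v)-f(v'))$, the sum over neighbours of $v$. For $u:\mathcal{N}\to\mathbb{R}$ let $f$ be its unique extension to $V$ with $\Delta f=0$ at non-node vertices; the response matrix $L$ is the (symmetric $n\times n$) matrix of the linear map $u\mapsto-\Delta f|_{\mathcal{N}}$. Subsets $A,B\subset\mathcal{N}$ are noninterlaced if they are contained in disjoint intervals of the circular ordering of $\mathcal{N}$. The network is well-connected if for any pair of noninterlaced subsets $A,B\subset\mathcal{N}$ of the same cardinality $k$, there is a pairwise vertex-disjoint set of $k$ paths in $\mathcal{G}$, with no nodes other than their endpoints, connecting in pairs the nodes in $A$ to those in $B$. Equivalently (a known result of Colin de Verdière), all noninterlaced minors $\det(L_{a_s,b_t})_{s,t=1}^k$, with $A=\{a_1,\dots,a_k\}$, $B=\{b_1,\dots,b_k\}$ ordered so that $a_1,\dots,a_k,b_k,\dots,b_1$ are in cyclic order, are strictly positive. Small central minors of a symmetric $n\times n$ matrix $M$ (indices modulo $n$): let $$\mathrm{CM}_{a,b,y}(M)=\det M_{a,a+1,\dots,a+y-1}^{\,b+y-1,\dots,b+1,b},$$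 the determinant of the $y\times y$ submatrix with rows $a,a+1,\dots,a+y-1$ (in this order) and columns $b+y-1,\dots,b+1,b$ (in this order), and let $\mathrm{CM}_{x,y}(M)=\mathrm{CM}_{a,b,y}(M)$ with $$a=\left\lfloor\frac{x-y}{2}\right\rfloor,\qquad b=\left\lfloor\frac{x-y+n-((n-1)\bmod 2)}{2}\right\rfloor .$$ The small central minors of the symmetric matrix $M$ are the $\mathrm{CM}_{x,y}(M)$ with $1\le x\le n$ and either $1\le y<n/2$, or $y=n/2$ and $x+y$ odd. *)

(* Defs.v *)
From mathcomp Require Import all_boot all_order all_algebra.
From mathcomp Require Import all_classical all_reals all_analysis.
Set Implicit Arguments.
Unset Strict Implicit.
Unset Printing Implicit Defensive.
Import Order.TTheory GRing.Theory Num.Theory.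
Import numFieldNormedType.Exports.
Local Open Scope ring_scope.

(* The node labelled k in {1, ..., n} is the residue of k modulo n in 'I_n, so
   that the label n is 0 : 'I_n; this preserves the cyclic order. *)

Lemma cyc_subproof (n : nat) (n_gt0 : (0 < n)%N) (z : int) :
  (`|(z %% n)%Z| < n)%N.
Proof.
have n0 : n%:Z != 0 by rewrite -lt0n.
by rewrite -ltz_nat gez0_abs ?modz_ge0 // ltz_pmod.
Qed.

Definition cyc (n : nat) (n_gt0 : (0 < n)%N) (z : int) : 'I_n :=
  Ordinal (cyc_subproof n_gt0 z).

(* Parallel edges (and loops, which affect neither the Laplacian nor the
   simple paths) are allowed; the orientation given by ends is irrelevant. *)
Record multigraph := Multigraph {
  vertex : finType;
  edge : finType;
  ends : edge -> vertex * vertex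
}.

Definition joins (G : multigraph) (e : edge G) (v w : vertex G) : bool :=
  (ends e == (v, w)) || (ends e == (w, v)).

Definition adj (G : multigraph) : rel (vertex G) :=
  fun v w => [exists e, joins e v w].

Record network (R : realType) (n : nat) := Network {
  graph :> multigraph;
  conductance : edge graph -> R;
  node : 'I_n -> vertex graph;
  conductance_gt0 : forall e, 0 < conductance e;
  node_inj : injective node;
  component_has_node : forall v, exists i, connect (@adj graph) v (node i)
}.

Arguments node {R n} G i : rename.

Section Network.
Local Open Scope classical_set_scope.
Variables (R : realType) (n : nat) (G : network R n).

Definition cond (v w : vertex G) : R := \sum_(e | joins e v w) conductance e.

Definition laplacian (f : vertex G -> R) (v : vertex G) : R :=
  \sum_(w | adj v w) cond v w * (f v - f w).

Definition is_harmonic_extension (u : 'I_n -> R) (f : vertex G -> R) : Prop :=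
  (forall i, f (node G i) = u i) /\
  (forall v, v \notin codom (node G) -> laplacian f v = 0).

(* The default value is never used: the extension exists and is unique. *)
Definition harmonic_extension (u : 'I_n -> R) : vertex G -> R :=
  xget (fun=> 0) [set f | is_harmonic_extension u f].

Definition response (u : 'I_n -> R) (i : 'I_n) : R :=
  - laplacian (harmonic_extension u) (node G i).

Definition response_matrix : 'M[R]_n :=
  \matrix_(i, j) response (fun k => (k == j)%:R) i.

Record drawing := Drawing {
  pos : vertex G -> R * R;
  curve : edge G -> R -> R * R
}.

Definition is_plane_embedding (d : drawing) : Prop :=
  [/\ injective (pos d),
      forall e, [/\ {within `[0, 1], continuous (curve d e)},
        curve d e 0 = pos d (ends e).1,
        curve d e 1 = pos d (ends e).2 &
        {in `]0, 1[ &, injective (curve d e)}],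
      forall e t v, t \in `]0, 1[ -> curve d e t <> pos d v &
      forall e e' s t, s \in `]0, 1[ -> t \in `]0, 1[ -> e <> e' ->
        curve d e s <> curve d e' t].

Definition drawn (d : drawing) : set (R * R) :=
  range (pos d) `|` \bigcup_e (curve d e @` `[0, 1]).

Definition outer_face (d : drawing) : set (R * R) :=
  [set x | ~ drawn d x /\ ~ bounded_set (connected_component (~` drawn d) x)].

Definition jordan_curve (g : R -> R * R) : Prop :=
  [/\ {within `[0, 1], continuous g}, g 0 = g 1 &
      {in `[0, 1[ &, injective g}].

Definition inside (g : R -> R * R) : set (R * R) :=
  let C := g @` `[0, 1] in
  [set x | ~ C x /\ bounded_set (connected_component (~` C) x)].

(* A node may be visited several times by the boundary of the outer face, and
   the network need not be connected; the cyclic order of the nodes is read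
   along a simple closed curve that surrounds the drawing and touches it
   exactly at the nodes. *)
Definition nodes_in_cyclic_order (d : drawing) : Prop :=
  exists (g : R -> R * R) (t : 'I_n -> R),
    [/\ jordan_curve g,
        forall i, g (t i) = pos d (node G i) /\ (t i \in `[0, 1[),
        forall i j : 'I_n, (i < j)%N -> t i < t j &
        drawn d `\` range (pos d \o node G) `<=` inside g].

Definition circular_planar : Prop :=
  exists d : drawing,
    [/\ is_plane_embedding d,
        forall i, closure (outer_face d) (pos d (node G i)) &
        nodes_in_cyclic_order d].

End Network.

Definition cyclic_interval (n : nat) (s l : nat) : {set 'I_n} :=
  [set i : 'I_n | [exists t : 'I_l, i == s + t %[mod n]]].

Definition noninterlaced (n : nat) (A B : {set 'I_n}) : Prop :=
  exists s l s' l' : nat,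
    [/\ A \subset cyclic_interval n s l, B \subset cyclic_interval n s' l' &
        [disjoint cyclic_interval n s l & cyclic_interval n s' l']].

(* The path starting at the node a of A has vertices node a :: p a. *)
Definition disjointly_connected (R : realType) (n : nat) (G : network R n)
    (A B : {set 'I_n}) : Prop :=
  exists (b : 'I_n -> 'I_n) (p : 'I_n -> seq (vertex G)),
    [/\ b @: A = B,
        forall a, a \in A ->
          [/\ path (@adj G) (node G a) (p a),
              uniq (node G a :: p a),
              last (node G a) (p a) = node G (b a) &
              forall i, node G i \in node G a :: p a -> i = a \/ i = b a] &
        forall a a', a \in A -> a' \in A -> a != a' ->
          [disjoint node G a :: p a & node G a' :: p a']].

Definition well_connected (R : realType) (n : nat) (G : network R n) : Prop :=
  forall A B : {set 'I_n}, noninterlaced A B -> #|A| = #|B| ->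
    disjointly_connected G A B.

Definition CMab (R : realType) (n : nat) (n_gt0 : (0 < n)%N) (M : 'M[R]_n)
    (a b : int) (y : nat) : R :=
  \det (\matrix_(i < y, j < y)
    M (cyc n_gt0 (a + i%:Z)) (cyc n_gt0 (b + y%:Z - 1 - j%:Z))).

Definition CM (R : realType) (n : nat) (n_gt0 : (0 < n)%N) (M : 'M[R]_n)
    (x y : nat) : R :=
  CMab n_gt0 M ((x%:Z - y%:Z) %/ 2)%Z
    ((x%:Z - y%:Z + n%:Z - ((n - 1) %% 2)%N%:Z) %/ 2)%Z y.

Definition small_central (n x y : nat) : bool :=
  [&& (1 <= x <= n)%N, (1 <= y)%N &
      (y.*2 < n)%N || ((y.*2 == n) && odd (x + y))].

(* Main.v *)
Require Import Defs.
From mathcomp Require Import all_boot all_order all_algebra.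
From mathcomp Require Import all_classical all_reals all_analysis.
From mathcomp Require Import fingroup perm zify ring.
Import Order.TTheory GRing.Theory Num.Theory.
Local Open Scope ring_scope.

Set Implicit Arguments.
Unset Strict Implicit.
Unset Printing Implicit Defensive.

(** The hypothesis makes every noninterlaced minor of the response matrix L
    positive, by algebra that holds for any symmetric matrix, and a nonzero
    noninterlaced minor yields disjoint paths, by expanding a determinant.

    Algebra.  Let D(a, b, y) be the minor of L with rows a, ..., a + y - 1 and
    columns b + y - 1, ..., b, indices being taken modulo n.  Dodgson
    condensation reads, thanks to the reversed order of the columns,
      D(a, b+1, y) D(a+1, b, y)
        = D(a, b, y+1) D(a+1, b+1, y-1) + D(a, b, y) D(a+1, b+1, y),
    without any minus sign.  Call b - a the gap of D(a, b, y).  The factors other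
    than D(a, b+1, y) have gap b - a, except D(a+1, b, y), whose gap is one
    less, so positivity for two consecutive gaps propagates to the next one
    (arc_minors_pos_step).  Since L is symmetric, D(a, b, y) = D(b, a + n, y),
    which exchanges the gaps d and n - d; hence it is enough to start from the
    two gaps in the middle, where the small central minors give all the signs
    (arc_minors_gt0).  For two disjoint arcs of the circle, this makes all
    minors on consecutive rows and consecutive columns of the corresponding
    rectangular submatrix positive, and by Fekete's criterion all its minors
    are positive (minor_gt0).  Condensation and the induction step of Fekete's
    criterion are both instances of one three-term Pluecker relation
    (rowdet_exchange).

    Combinatorics.  The response matrix is minus a Schur complement of the
    Laplacian K of the network, so a nonzero minor of L with rows A and columns
    B gives a nonzero determinant of K with rows A + I and columns B + I, where
    I is the set of the vertices that are not nodes (det_kirchhoff).  By the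
    Leibniz formula there is a bijection s from A + I to B + I with
    K v (s v) <> 0, that is, with v and s v equal or adjacent, for all v.
    Iterating s from a vertex of A gives a path through I that stops when it
    reaches B, and paths from different vertices are disjoint because s is
    injective (disjointly_connected_of_perm). *)

(** * The three-term Pluecker relation *)

Lemma det_mx22 (F : comNzRingType) (A : 'M[F]_2) :
  \det A = A 0 0 * A 1 1 - A 0 1 * A 1 0.
Proof.
rewrite (expand_det_row _ 0) !big_ord_recl big_ord0 addr0 /cofactor !det_mx11.
rewrite !mxE /= expr0 mul1r.
have -> : lift 0 0 = 1 :> 'I_2 by apply/val_inj.
have -> : lift 1 0 = 0 :> 'I_2 by apply/val_inj.
by rewrite expr1; ring.
Qed.

(** If one of these determinants is nonzero, a change of basis makes [X] the
    projection on the last [m] coordinates, and all of them become 2 x 2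
    determinants of the first two coordinates, for which the relation is an
    identity of polynomials.  If all of them vanish there is nothing to prove. *)
Lemma plucker (F : fieldType) (m : nat) (a b c d : 'rV[F]_(1 + 1 + m))
    (X : 'M[F]_(m, 1 + 1 + m)) :
  let P u v := \det (col_mx (col_mx u v) X) in
  P a c * P b d = P a b * P c d + P a d * P b c.
Proof.
move=> P.
have minor2 u0 v0 : P u0 v0 != 0 ->
    P a c * P b d = P a b * P c d + P a d * P b c.
  set B := col_mx (col_mx u0 v0) X => P0.
  have Bunit : B \in unitmx by rewrite unitmxE unitfE.
  pose Q : 'M[F]_(1 + 1 + m) := invmx B.
  pose Y (u : 'rV[F]_(1 + 1 + m)) : 'rV[F]_(1 + 1) := lsubmx (u *m Q).
  have XQ : X *m Q = row_mx 0 1%:M.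
    have /(congr1 dsubmx) : B *m Q = 1%:M by rewrite mulmxV.
    by rewrite mul_col_mx col_mxKd scalar_mx_block /block_mx col_mxKd.
  have PQ u v : P u v * \det Q = Y u 0 0 * Y v 0 1 - Y u 0 1 * Y v 0 0.
    rewrite /P -det_mulmx mul_col_mx XQ -[col_mx u v *m Q]hsubmxK -block_mxEv.
    have row0 k : lsubmx (col_mx u v *m Q) 0 k = Y u 0 k.
      by rewrite mul_col_mx !mxE; case: splitP => // i _; rewrite (ord1 i) !mxE.
    have row1 k : lsubmx (col_mx u v *m Q) 1 k = Y v 0 k.
      rewrite mul_col_mx !mxE; case: splitP => [[[]]|i _] //.
      by rewrite (ord1 i) !mxE.
    by rewrite det_ublock det1 mulr1 det_mx22 !row0 !row1.
  have Q0 : \det Q != 0 by rewrite -unitfE -unitmxE unitmx_inv.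
  apply: (mulIf Q0); apply: (mulIf Q0).
  have regroup x y : x * y * \det Q * \det Q = (x * \det Q) * (y * \det Q).
    by ring.
  by rewrite !mulrDl !regroup !PQ; ring.
have [ac0|] := eqVneq (P a c) 0; last exact: minor2.
have [ab0|] := eqVneq (P a b) 0; last exact: minor2.
have [ad0|] := eqVneq (P a d) 0; last exact: minor2.
by rewrite ac0 ab0 ad0 !mul0r addr0.
Qed.

(** Rows are functions on [nat] of which only the first [k] values matter, so
    that the same rows can be used in determinants of different sizes, and
    their order is handled by operations on lists. *)
Definition rowdet (F : fieldType) (k : nat) (s : seq (nat -> F)) : F :=
  \det (\matrix_(i < k, j < k) nth (fun=> 0) s i j).

Lemma rowdet_swap (F : fieldType) (k : nat) (s t : seq (nat -> F)) x y :
  ((size s).+1 < k)%N ->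
  rowdet k (s ++ x :: y :: t) = - rowdet k (s ++ y :: x :: t).
Proof.
move=> lt_s_k; have lt_s_k' := ltnW lt_s_k.
pose i0 := Ordinal lt_s_k'; pose i1 := Ordinal lt_s_k.
have i01 : i0 != i1 by rewrite -val_eqE /= neq_ltn ltnSn.
rewrite /rowdet -mulN1r.
have -> : -1 = \det (tperm_mx i0 i1 : 'M[F]_k).
  by rewrite det_perm odd_tperm i01 expr1.
rewrite -det_mulmx -xrowE; congr (\det _); apply/matrixP => i j.
rewrite !mxE; congr (_ _); rewrite !nth_cat.
case: tpermP => [->|->|/eqP ni0 /eqP ni1] /=.
- by rewrite ltnn subnn ltnNge leqnSn /= subSn // subnn.
- by rewrite ltnn subnn ltnNge leqnSn /= subSn // subnn.
have [//|le_si] := ltnP i (size s).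
have := ni1; have := ni0; rewrite -!val_eqE /=.
case: (i - size s)%N (subnKC le_si) => [|[|l]] <- //=.
  by rewrite addn0 eqxx.
by rewrite addn1 eqxx.
Qed.

Lemma rowdet_front (F : fieldType) (k : nat) (s t : seq (nat -> F)) x :
  (size s < k)%N ->
  rowdet k (s ++ x :: t) = (-1) ^+ size s * rowdet k (x :: s ++ t).
Proof.
elim/last_ind: s t => [|s y IHs] t; first by rewrite mul1r.
rewrite size_rcons !cat_rcons => lt_s_k; rewrite rowdet_swap //.
by rewrite IHs ?(ltnW lt_s_k) // exprS mulN1r mulNr.
Qed.

Lemma rowdet_plucker (F : fieldType) (s : seq (nat -> F)) (a b c d : nat -> F) :
  let P u v := rowdet (size s).+2 [:: u, v & s] in
  P a c * P b d = P a b * P c d + P a d * P b c.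
Proof.
pose m := size s; pose V (u : nat -> F) : 'rV[F]_(1 + 1 + m) := \row_j u j.
pose X : 'M[F]_(m, 1 + 1 + m) := \matrix_(i, j) nth (fun=> 0) s i j.
have PE u v : rowdet m.+2 [:: u, v & s] = \det (col_mx (col_mx (V u) (V v)) X).
  congr (\det _); apply/matrixP => i j; rewrite !mxE.
  case: splitP => l /= ->; last by rewrite !mxE.
  by rewrite !mxE; case: splitP => l' /= ->; rewrite (ord1 l') !mxE.
by move=> P; rewrite /P !PE plucker.
Qed.

(** The relation for the rows [x], [y], [z], [e] of a determinant whose other
    rows are [s ++ t].  Placing each row at its position in the order
    x, s, y, t, z, e absorbs all the signs, so that positivity of five of the
    factors implies that of the sixth. *)
Lemma rowdet_exchange (F : fieldType) (s t : seq (nat -> F)) (x y z e : nat -> F) :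
  let D := rowdet (size s + size t).+2 in
  D (x :: s ++ t ++ [:: z]) * D (s ++ y :: t ++ [:: e]) =
  D (x :: s ++ y :: t) * D (s ++ t ++ [:: z; e]) +
  D (x :: s ++ t ++ [:: e]) * D (s ++ y :: t ++ [:: z]).
Proof.
move=> D; pose Q u v := D [:: u, v & s ++ t].
have szst : (size s + size t = size (s ++ t))%N by rewrite size_cat.
have QN u v : Q v u = - Q u v.
  exact: (@rowdet_swap F _ [::]).
have lastE u v : D (u :: s ++ t ++ [:: v]) = (-1) ^+ (size (s ++ t)).+1 * Q v u.
  by rewrite catA -cat_cons {1}/D rowdet_front /= ?cats0 // -szst.
have midE u v : D (u :: s ++ v :: t) = (-1) ^+ (size s).+1 * Q v u.
  by rewrite -cat_cons {1}/D rowdet_front //= ltnS ltnS leq_addr.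
have bothE u v : D (s ++ u :: t ++ [:: v]) =
    (-1) ^+ (size (s ++ t)).+1 * ((-1) ^+ (size s).+1 * Q u v).
  rewrite -midE -[s ++ _]/(s ++ (u :: t) ++ [:: v]) catA {1}/D rowdet_front.
    by rewrite cats0 !size_cat /= addnS.
  by rewrite size_cat /= addnS.
have endE u v : D (s ++ t ++ [:: u; v]) = (-1) ^+ (size (s ++ t)).+1 *
    ((-1) ^+ (size (s ++ t)).+1 * Q u v).
  rewrite -lastE -[[:: u; v]]/([:: u] ++ [:: v]) !catA {1}/D rowdet_front.
    by rewrite cats0 !size_cat /= addn1.
  by rewrite !size_cat /= addn1.
rewrite lastE bothE midE endE lastE bothE.
rewrite (QN x z) (QN x y) (QN x e).
(* Each of the three products carries the sign sg * sg * tau. *)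
set sg := (-1) ^+ _; set tau := (-1) ^+ _.
transitivity (- (sg * sg * tau) * (Q x z * Q y e)); first by ring.
by rewrite /Q /D szst rowdet_plucker; ring.
Qed.

Lemma rowdet_last (F : fieldType) (k : nat) (s : seq (nat -> F)) : size s = k ->
  rowdet k.+1 (rcons s (fun j => (j == k)%:R)) = rowdet k s.
Proof.
move=> szs; rewrite /rowdet (expand_det_row _ ord_max) (bigD1 ord_max) //=.
rewrite big1 => [|j /negPf jmax]; last first.
  by rewrite mxE nth_rcons szs ltnn eqxx -[k]/(val (@ord_max k)) val_eqE jmax mul0r.
rewrite mxE nth_rcons szs ltnn !eqxx mul1r addr0 /cofactor /= addnn.
rewrite -signr_odd odd_double expr0 mul1r; congr (\det _).
by apply/matrixP => i j; rewrite !mxE !lift_max nth_rcons szs ltn_ord.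
Qed.

Lemma rowdet_first (F : fieldType) (k : nat) (s : seq (nat -> F)) : size s = k ->
  rowdet k.+1 ((fun j => (j == 0%N)%:R) :: s) =
  rowdet k [seq (fun j => v j.+1) | v <- s].
Proof.
move=> szs; rewrite /rowdet (expand_det_row _ ord0) (bigD1 ord0) //=.
rewrite big1 => [|j j0]; last first.
  by rewrite mxE /= -[0%N]/(val (@ord0 k)) val_eqE (negPf j0) mul0r.
rewrite mxE /= mul1r addr0 /cofactor expr0 mul1r; congr (\det _).
apply/matrixP => i j; rewrite !mxE /= (nth_map (fun=> 0)) ?szs //.
Qed.

(** * Minors along lists of rows and columns *)

Definition minor (F : fieldType) (f : nat -> nat -> F) (r c : seq nat) : F :=
  \det (\matrix_(i < size c, j < size c) f (nth 0%N r i) (nth 0%N c j)).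

Lemma minorE (F : fieldType) (f : nat -> nat -> F) (r c : seq nat) :
  size r = size c ->
  minor f r c = rowdet (size c) [seq (fun j => f x (nth 0%N c j)) | x <- r].
Proof.
move=> szr; congr (\det _); apply/matrixP => i j.
by rewrite !mxE (nth_map 0%N) // szr.
Qed.

Lemma minor_tr (F : fieldType) (f : nat -> nat -> F) (r c : seq nat) :
  size r = size c -> minor (fun i j => f j i) c r = minor f r c.
Proof.
move=> szr; rewrite /minor szr -det_tr; congr (\det _).
by apply/matrixP => i j; rewrite !mxE.
Qed.

(** Appending a unit vector as last row deletes the last column.  Together with
    the next lemma, it lets minors of different sizes enter one Pluecker
    relation. *)
Lemma minor_rowdet_last (F : fieldType) (f : nat -> nat -> F) (r c : seq nat) v :
  size r = size c ->
  rowdet (size c).+1 (rcons [seq (fun j => f x (nth 0%N (rcons c v) j)) | x <- r]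
    (fun j => (j == size c)%:R)) = minor f r c.
Proof.
move=> szr; rewrite rowdet_last ?size_map //; congr (\det _).
by apply/matrixP => i j; rewrite !mxE (nth_map 0%N) ?szr // nth_rcons ltn_ord.
Qed.

Lemma minor_rowdet_first (F : fieldType) (f : nat -> nat -> F) (r c : seq nat) u :
  size r = size c ->
  rowdet (size c).+1 ((fun j => (j == 0%N)%:R) ::
    [seq (fun j => f x (nth 0%N (u :: c) j)) | x <- r]) = minor f r c.
Proof.
move=> szr; rewrite rowdet_first ?size_map // -map_comp.
by rewrite minorE.
Qed.

(** The identity behind Fekete's criterion: [rowdet_exchange] with the last unit
    vector as row [e].  The factors of full size on the right have rows spread
    over a shorter range than [x :: s ++ t ++ [:: z]], as soon as [y] lies in
    between, and the other factors have one column less. *)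
Lemma minor_exchange (F : fieldType) (f : nat -> nat -> F) (s t c : seq nat)
    (x y z v : nat) : size c = (size s + size t).+1 ->
  minor f (x :: s ++ t ++ [:: z]) (rcons c v) * minor f (s ++ y :: t) c =
  minor f (x :: s ++ y :: t) (rcons c v) * minor f (s ++ t ++ [:: z]) c +
  minor f (x :: s ++ t) c * minor f (s ++ y :: t ++ [:: z]) (rcons c v).
Proof.
move=> szc.
pose g x j := f x (nth 0%N (c ++ [:: v]) j).
have := rowdet_exchange (map g s) (map g t) (g x) (g y) (g z)
          (fun j => (j == size c)%:R).
rewrite !size_map => exch.
rewrite !(@minorE _ f _ (rcons c v)) ?size_rcons ?size_cat /= ?size_cat /=
  ?szc ?addnS ?addn0 //.
rewrite -!(@minor_rowdet_last _ f _ c v) ?size_rcons ?size_cat /= ?size_cat /=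
  ?szc ?addnS ?addn0 //.
rewrite !map_cat /= !map_cat /= -!cats1 -!catA /= -?catA -szc in exch *.
exact: exch.
Qed.

(** Dodgson condensation is [rowdet_exchange] for the rows e0, x, X, z, e1, where
    e0 and e1 are the first and the last unit vectors. *)
Lemma minor_dodgson (F : fieldType) (f : nat -> nat -> F) (X C : seq nat)
    (x z u v : nat) : size X = size C ->
  minor f (rcons X z) (rcons C v) * minor f (x :: X) (u :: C) =
  minor f (x :: X) (rcons C v) * minor f (rcons X z) (u :: C) +
  minor f X C * minor f (x :: rcons X z) (u :: rcons C v).
Proof.
move=> szX.
have cats2 (T : Type) (q : seq T) b b' : rcons (rcons q b) b' = q ++ [:: b; b'].
  by rewrite -!cats1 -catA.
pose g x j := f x (nth 0%N (u :: rcons C v) j).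
pose e0 (j : nat) : F := (j == 0%N)%:R.
pose e1 (j : nat) : F := (j == (size C).+1)%:R.
have := rowdet_exchange [::] (map g X) e0 (g x) (g z) e1.
rewrite /= size_map szX => exch.
rewrite -!(@minor_rowdet_first _ f _ (rcons C v) u) ?size_rcons /= ?szX //.
rewrite -!(@minor_rowdet_last _ f _ (u :: C) v) ?size_rcons /= ?szX //.
rewrite [minor f (x :: _) _]minorE /= ?size_rcons ?szX //.
have -> : minor f X C = rowdet (size C).+2 (e0 :: rcons (map g X) e1).
  rewrite rowdet_first ?size_rcons ?size_map ?szX // map_rcons -map_comp.
  by rewrite -(@minor_rowdet_last _ f X C v).
by move: exch; rewrite !map_rcons -cats2 !cats1.
Qed.

(** * Fekete's criterion *)

Lemma ltn_sorted_split (s t : seq nat) y : sorted ltn (s ++ t) ->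
  all (ltn^~ y) s -> all (ltn y) t -> sorted ltn (s ++ y :: t).
Proof.
rewrite !(sorted_pairwise ltn_trans) !pairwise_cat /= => /and3P[st -> ->] sy ty.
by rewrite allrel_consr sy st ty.
Qed.

(** Induction on the number of columns and, for a given number, on the length of
    an interval that contains the rows.  Rows without a gap are covered by the
    hypothesis.  Otherwise insert a row [y] of a gap: in [minor_exchange], the
    minors with one column less are positive by the first induction, and the
    two remaining factors on the right by the second one.  Only prefixes of the
    column list occur, so the columns can be arbitrary. *)
Lemma minor_gt0_row (R : realFieldType) (f : nat -> nat -> R) (p : nat)
    (c : seq nat) :
  (forall i k, (i + k <= p)%N -> (k <= size c)%N ->
     0 < minor f (iota i k) (take k c)) ->
  forall r, sorted ltn r -> all (ltn^~ p) r -> size r = size c ->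
    0 < minor f r c.
Proof.
elim/last_ind: c => [|c v IHc] pos r r_sorted r_lt szr.
  by rewrite /minor det_mx00.
have {}IHc s : sorted ltn s -> all (ltn^~ p) s -> size s = size c ->
    0 < minor f s c.
  apply: IHc => i k le_p le_k; have := pos i k le_p.
  by rewrite size_rcons -cats1 takel_cat // => ->//; rewrite leqW.
rewrite size_rcons in szr.
suff range N lo : (lo + N <= p)%N -> all (leq lo) r -> all (ltn^~ (lo + N)%N) r ->
    0 < minor f r (rcons c v).
  apply: (range p 0%N) => //; first exact/allP.
elim: N lo r r_sorted {r_lt} szr => [|N IHN] lo r r_sorted szr le_p ge_lo lt_hi.
  case: r szr ge_lo lt_hi {r_sorted} => //= x r _ /andP[ge_x _] /andP[].
  by rewrite addn0 ltnNge ge_x.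
have r_lt : all (ltn^~ p) r.
  by apply: sub_all lt_hi => x lt_x; apply: leq_trans lt_x _.
case: r => [//|x r] in r_sorted szr ge_lo lt_hi r_lt *.
case/lastP: r => [|s z] in r_sorted szr ge_lo lt_hi r_lt *.
  have := pos x 1%N; rewrite take_oversize ?size_rcons -?szr //=.
  by apply=> //; case/andP: r_lt; rewrite addn1.
have := r_sorted; rewrite (sorted_pairwise ltn_trans) /= all_rcons.
rewrite pairwise_rcons => /and3P[/andP[lt_xz xs] sz s_pw].
have s_sorted : sorted ltn s by rewrite (sorted_pairwise ltn_trans).
(* The rows have no gap between the first one x and the last one z. *)
have [gapless|/allPn[y]] := boolP (all (mem s) (iota x.+1 (z - x.+1))).
  have sE : s = iota x.+1 (z - x.+1).
    apply: (irr_sorted_eq ltn_trans ltnn) => //; first exact: iota_ltn_sorted.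
    move=> w; apply/idP/idP => [ws|/(allP gapless)//].
    by rewrite mem_iota subnKC // (allP xs) // (allP sz).
  have szs : size s = (z - x.+1)%N by rewrite sE size_iota.
  have rE : x :: rcons s z = iota x (size c).+1.
    rewrite -szr -[size _]/(size (rcons s z)).+1 size_rcons -/(iota x.+1 _).
    rewrite -[iota x _]/(x :: iota x.+1 (size s).+1) -[(size s).+1]addn1 iotaD.
    by rewrite -cats1 szs subnKC // -sE.
  rewrite rE -[rcons c v]take_size size_rcons; apply: pos; last first.
    by rewrite size_rcons.
  have : (z < p)%N by move: r_lt; rewrite /= all_rcons => /and3P[].
  by move: szr; rewrite /= size_rcons szs; lia.
rewrite mem_iota subnKC // => /andP[lt_xy lt_yz] ys.
pose s1 := [seq w <- s | (w < y)%N]; pose s2 := [seq w <- s | (y < w)%N].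
have sE : s = s1 ++ s2.
  apply: (irr_sorted_eq ltn_trans ltnn) => //.
    rewrite (sorted_pairwise ltn_trans) pairwise_cat !pairwise_filter //.
    rewrite !andbT; apply/allrelP => w1 w2; rewrite !mem_filter.
    by move=> /andP[lt1 _] /andP[lt2 _]; apply: ltn_trans lt1 lt2.
  move=> w; rewrite mem_cat !mem_filter -andb_orl -neq_ltn.
  by case: eqVneq => // ->; exact: (negPf ys).
have s1y : all (ltn^~ y) s1 by exact: filter_all.
have s2y : all (ltn y) s2 by exact: filter_all.
move: s1 s2 s1y s2y sE => s1 s2 s1y s2y sE; subst s.
have sy_sorted : sorted ltn (s1 ++ y :: s2) by exact: ltn_sorted_split.
have syz_sorted : sorted ltn ((s1 ++ y :: s2) ++ [:: z]).
  have -> : (s1 ++ y :: s2) ++ [:: z] = s1 ++ y :: (s2 ++ [:: z]).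
    by rewrite -catA.
  apply: ltn_sorted_split => //; last by rewrite all_cat s2y /= lt_yz.
  by move: r_sorted => /path_sorted; rewrite -cats1 -catA.
have szc : size c = (size s1 + size s2).+1.
  by move: szr; rewrite /= size_rcons size_cat => -[].
have szr1 : size (x :: s1 ++ y :: s2) = (size c).+1.
  by rewrite /= size_cat /= szc addnS.
have szr2 : size (s1 ++ y :: s2 ++ [:: z]) = (size c).+1.
  by rewrite !size_cat /= size_cat /= szc !addnS addn0.
have between : all (fun w => (x < w < z)%N) (s1 ++ y :: s2).
  have : all (fun w => (x < w < z)%N) (s1 ++ s2).
    by rewrite all_predI xs sz.
  by rewrite !all_cat /= lt_xy lt_yz => /andP[-> ->].
have ss_sorted : sorted ltn (s1 ++ s2) by move: s_sorted.
have exch := minor_exchange f x y z v szc.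
have ge_x : (lo <= x)%N by case/andP: ge_lo.
have lt_z : (z < lo + N.+1)%N.
  by move: lt_hi; rewrite /= all_rcons => /and3P[].
have m1 : 0 < minor f (s1 ++ y :: s2) c.
  apply: IHc => //; last by rewrite size_cat /= szc addnS.
  apply: sub_all between => w /= /andP[_ lt_wz].
  by apply: leq_trans le_p; apply: ltn_trans lt_z.
have m2 : 0 < minor f (s1 ++ s2 ++ [:: z]) c.
  apply: IHc.
  - by move/path_sorted: r_sorted; rewrite -cats1 -catA.
  - by move: r_lt; rewrite /= -cats1 -catA => /andP[].
  - by rewrite !size_cat /= szc addnS addn0 addnS.
have m3 : 0 < minor f (x :: s1 ++ s2) c.
  apply: IHc.
  - move: r_sorted; rewrite -rcons_cons -cats1.
    rewrite (sorted_pairwise ltn_trans) pairwise_cat => /and3P[_ + _].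
    by rewrite -(sorted_pairwise ltn_trans).
  - by move: r_lt; rewrite -rcons_cons all_rcons => /andP[].
  - by rewrite /= !size_cat /= szc.
have M1 : 0 < minor f (x :: s1 ++ y :: s2) (rcons c v).
  apply: (IHN lo) => //; first 3 last.
  - have lt_N w : (w < z)%N -> (w < lo + N)%N.
      by move=> lt_wz; rewrite -ltnS -addnS; apply: leq_ltn_trans lt_z.
    rewrite /= lt_N ?(ltn_trans lt_xy) //.
    by apply: sub_all between => w /= /andP[_ /lt_N].
  - by move: between sy_sorted; case: (s1) => [|w q] /= /andP[/andP[-> _] _].
  - by apply: leq_trans le_p; rewrite leq_add2l.
  - rewrite /= ge_x; apply: sub_all between => w /= /andP[lt_xw _].
    exact: leq_trans ge_x (ltnW lt_xw).
have M2 : 0 < minor f (s1 ++ y :: s2 ++ [:: z]) (rcons c v).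
  apply: (IHN lo.+1).
  - by rewrite -[_ ++ _]/(s1 ++ (y :: s2) ++ [:: z]) catA.
  - exact: szr2.
  - by rewrite addSnnS.
  - rewrite -[_ ++ _]/(s1 ++ (y :: s2) ++ [:: z]) catA all_cat /= andbT.
    rewrite (leq_ltn_trans ge_x lt_xz) andbT.
    apply: sub_all between => w /= /andP[lt_xw _].
    exact: leq_ltn_trans ge_x lt_xw.
  - rewrite -[_ ++ _]/(s1 ++ (y :: s2) ++ [:: z]) catA all_cat /= andbT.
    rewrite addSnnS lt_z andbT; apply: sub_all between => w /= /andP[_ lt_wz].
    exact: ltn_trans lt_z.
by rewrite -(pmulr_lgt0 _ m1) -cats1 -catA exch addr_gt0 ?mulr_gt0.
Qed.

(** Fekete's criterion: [minor_gt0_row] is applied first to consecutive columns,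
    to free the rows, and then to the transposed matrix, to free the columns. *)
Lemma minor_gt0 (R : realFieldType) (f : nat -> nat -> R) (p q : nat) :
  (forall i j k, (i + k <= p)%N -> (j + k <= q)%N ->
     0 < minor f (iota i k) (iota j k)) ->
  forall r c, sorted ltn r -> sorted ltn c -> all (ltn^~ p) r ->
    all (ltn^~ q) c -> size r = size c -> 0 < minor f r c.
Proof.
move=> pos r c r_sorted c_sorted r_lt c_lt szr.
rewrite -minor_tr //; apply: minor_gt0_row c_lt _ => // j k le_q le_r.
rewrite minor_tr; last by rewrite size_iota size_takel.
apply: (@minor_gt0_row _ _ p) => //.
- move=> i l le_p; rewrite size_iota => le_k; rewrite take_iota (minn_idPl le_k).
  by apply: pos => //; apply: leq_trans le_q; rewrite leq_add2l.
- exact: take_sorted.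
- by apply/allP => x /mem_take xr; apply: (allP r_lt).
- by rewrite size_iota size_takel.
Qed.

(** * Minors on two arcs of the circle *)

(** Indices are integers rather than residues: the circle is unrolled, and its
    length enters only through the periodicity of [m] in the results below. *)
Definition arc_minor (F : fieldType) (m : int -> int -> F)
    (a b : int) (y : nat) : F :=
  \det (\matrix_(i < y, j < y) m (a + i%:Z) (b + y%:Z - 1 - j%:Z)).

Lemma minor_iota (F : fieldType) (m : int -> int -> F) (a b : int) (i j k : nat) :
  minor (fun i j => m (a + i%:Z) (b - j%:Z)) (iota i k) (iota j k) =
  arc_minor m (a + i%:Z) (b - j%:Z - k%:Z + 1) k.
Proof.
rewrite /minor size_iota; congr (\det _); apply/matrixP => u v; rewrite !mxE.
by rewrite !nth_iota //; congr m; lia.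
Qed.

(** The reversed order of the columns turns the difference in Dodgson's rule
    into a sum: this is the octahedron recurrence, with [b - a] as time. *)
Lemma arc_minor_dodgson (F : fieldType) (m : int -> int -> F) (a b : int) (y : nat) :
  arc_minor m a (b + 1) y.+1 * arc_minor m (a + 1) b y.+1 =
  arc_minor m a b y.+2 * arc_minor m (a + 1) (b + 1) y +
  arc_minor m a b y.+1 * arc_minor m (a + 1) (b + 1) y.+1.
Proof.
have := @minor_dodgson _ (fun i j => m (a + i%:Z) (b + y.+1%:Z - j%:Z))
  (iota 1 y) (iota 1 y) 0%N y.+1 0%N y.+1 (erefl _).
have -> : rcons (iota 1 y) y.+1 = iota 1 y.+1.
  by rewrite -[in RHS](addn1 y) iotaD add1n cats1.
rewrite -[0%N :: iota 1 y]/(iota 0 y.+1) -[0%N :: iota 1 y.+1]/(iota 0 y.+2).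
rewrite !minor_iota.
have -> : b + y.+1 - 1%:Z - y.+1%:Z + 1 = b by lia.
have -> : b + y.+1 - 0%N%:Z - y.+1%:Z + 1 = b + 1 by lia.
have -> : b + y.+1 - 1%:Z - y%:Z + 1 = b + 1 by lia.
have -> : b + y.+1 - 0%N%:Z - y.+2%:Z + 1 = b by lia.
by rewrite addr0 => eq1; rewrite mulrC eq1 addrC [X in X + _]mulrC.
Qed.

(** Exchanging the two arcs amounts to transposing the submatrix and reversing
    both its rows and its columns; the two reversals have the same sign. *)
Lemma arc_minorC (F : fieldType) (m : int -> int -> F) (a b : int) (y : nat) :
  (forall i j, m i j = m j i) -> arc_minor m a b y = arc_minor m b a y.
Proof.
move=> m_sym; pose s := perm (@rev_ord_inj y).
rewrite /arc_minor; set A := (X in \det X = _).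
have -> : \matrix_(i < y, j < y) m (b + i%:Z) (a + y%:Z - 1 - j%:Z) =
    row_perm s (col_perm s A^T).
  apply/matrixP => i j; rewrite !mxE !permE /= m_sym; congr m.
    by have := ltn_ord j; lia.
  by have := ltn_ord i; lia.
rewrite row_permE col_permE !det_mulmx det_tr !det_perm odd_permV mulrCA.
by rewrite -signr_addb addbb mulr1.
Qed.

Lemma int_periodic_ind (N : nat) (s : int) (P : int -> Prop) : (0 < N)%N ->
  (forall x, P x <-> P (x + N%:Z)) ->
  (forall x, s <= x -> x < s + N%:Z -> P x) -> forall x, P x.
Proof.
move=> N_gt0 per win x.
have shift q : forall z, P z <-> P (z + q * N%:Z).
  elim/int_rect: q => [|q IHq|q IHq] z; first by rewrite mul0r addr0.
    rewrite (per z) (IHq (z + N%:Z)); suff -> : z + N%:Z + q%:Z * N%:Z =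
      z + q.+1%:Z * N%:Z by [].
    by lia.
  rewrite (IHq z) (per (z + - q.+1%:Z * N%:Z)).
  by suff -> : z + - q.+1%:Z * N%:Z + N%:Z = z + - q%:Z * N%:Z by []; lia.
have N0 : N%:Z != 0 by lia.
rewrite (shift (- ((x - s) %/ N%:Z)%Z) x); apply: win.
  by have := modz_ge0 (x - s) N0; have := divz_eq (x - s) N%:Z; lia.
have : ((x - s) %% N%:Z)%Z < N%:Z by rewrite ltz_pmod.
by have := divz_eq (x - s) N%:Z; lia.
Qed.

(** The bounds on [y] say that the arcs of length [y] that start at [a] and at
    [a + d] are disjoint on a circle of length [n]. *)
Definition arc_minors_pos (R : realFieldType) (m : int -> int -> R)
    (n d : nat) : Prop :=
  forall a y, (y <= d)%N -> (d + y <= n)%N -> 0 < arc_minor m a (a + d%:Z) y.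

Lemma arc_minor0 (F : fieldType) (m : int -> int -> F) a b : arc_minor m a b 0 = 1.
Proof. by rewrite /arc_minor det_mx00. Qed.

(** The arcs at [a] and [a + (n - d)] are, in the other order, at distance [d]
    on the circle. *)
Lemma arc_minors_posC (R : realFieldType) (m : int -> int -> R) (n d : nat) :
  (forall i j, m i j = m j i) -> (forall i j, m i (j + n%:Z) = m i j) ->
  (d <= n)%N -> arc_minors_pos m n d -> arc_minors_pos m n (n - d).
Proof.
move=> m_sym m_per le_dn pos a y le_y le_n.
have -> : arc_minor m a (a + (n - d)%N%:Z) y =
    arc_minor m (a + (n - d)%N%:Z) (a + (n - d)%N%:Z + d%:Z) y.
  rewrite arc_minorC //; congr (\det _); apply/matrixP => i j; rewrite !mxE.
  by rewrite -m_per; congr m; lia.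
by apply: pos; lia.
Qed.

(** One step of the recurrence.  From the middle onwards, that is, if
    [n <= 2 * (d + 1)], every pair of disjoint arcs with gap [d + 2] gives
    pairs of disjoint arcs in the other five factors. *)
Lemma arc_minors_pos_step (R : realFieldType) (m : int -> int -> R) (n d : nat) :
  (n <= d.+1.*2)%N -> arc_minors_pos m n d -> arc_minors_pos m n d.+1 ->
  arc_minors_pos m n d.+2.
Proof.
move=> le_n pos0 pos1 a [|y] le_y le_dy; first by rewrite arc_minor0.
have := arc_minor_dodgson m a (a + d.+1%:Z) y.
have -> : a + d.+1%:Z + 1 = a + d.+2%:Z by lia.
have gt0 : 0 < arc_minor m (a + 1) (a + d.+1%:Z) y.+1.
  have -> : a + d.+1%:Z = a + 1 + d%:Z by lia.
  by apply: pos0; lia.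
rewrite -(pmulr_lgt0 _ gt0) => ->.
have -> : a + d.+2%:Z = a + 1 + d.+1%:Z by lia.
by rewrite addr_gt0 ?mulr_gt0 ?pos1 //; lia.
Qed.

Lemma arc_minor_per (F : fieldType) (m : int -> int -> F) (n : nat) a b y :
  (forall i j, m i (j + n%:Z) = m i j) ->
  arc_minor m a (b + n%:Z) y = arc_minor m a b y.
Proof.
move=> m_per; congr (\det _); apply/matrixP => i j; rewrite !mxE.
by rewrite -[RHS]m_per; congr m; lia.
Qed.

Definition central_minors_pos (R : realFieldType) (m : int -> int -> R)
    (n : nat) : Prop :=
  forall x y : nat, (1 <= x <= n)%N -> (1 <= y)%N ->
    (y.*2 < n)%N || ((y.*2 == n) && odd (x + y)) ->
    0 < arc_minor m ((x%:Z - y%:Z) %/ 2)%Z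
          ((x%:Z - y%:Z + n%:Z - ((n - 1) %% 2)%N%:Z) %/ 2)%Z y.

(** For odd [n] the central minors of size [y] form one sequence [E], in which
    the gaps [h] and [h + 1] alternate.  By [arc_minorC] it is [n]-periodic, so
    that the [n] minors given by the hypothesis determine all of it. *)
Lemma arc_minors_pos_odd (R : realFieldType) (m : int -> int -> R) (h : nat) :
  (forall i j, m i j = m j i) -> (forall i j, m i (j + h.*2.+1%:Z) = m i j) ->
  central_minors_pos m h.*2.+1 -> arc_minors_pos m h.*2.+1 h.
Proof.
move=> m_sym m_per central a [|y] le_y _; first by rewrite arc_minor0.
set n := h.*2.+1 in m_per central.
pose E (x : int) := arc_minor m ((x - y.+1%:Z) %/ 2)%Z
  ((x - y.+1%:Z + n%:Z) %/ 2)%Z y.+1.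
suff E_gt0 x : 0 < E x.
  have := E_gt0 (2 * a + y.+1%:Z); rewrite /E.
  have -> : ((2 * a + y.+1%:Z - y.+1%:Z) %/ 2)%Z = a by lia.
  by have -> : ((2 * a + y.+1%:Z - y.+1%:Z + n%:Z) %/ 2)%Z = a + h%:Z by lia.
apply: (@int_periodic_ind n 1 (fun x => 0 < E x)) => // {}x.
  suff -> : E (x + n%:Z) = E x by [].
  rewrite /E arc_minorC // -[RHS](arc_minor_per _ _ _ m_per) [RHS]arc_minorC //.
  rewrite [RHS]arc_minorC //.
  have -> : ((x + n%:Z - y.+1%:Z + n%:Z) %/ 2)%Z =
    ((x - y.+1%:Z) %/ 2)%Z + n%:Z by lia.
  have -> : (x - y.+1%:Z + n%:Z = x + n%:Z - y.+1%:Z) by lia.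
  rewrite arc_minorC // (arc_minor_per _ _ _ m_per) arc_minorC // arc_minor_per //.
move=> x_ge1 x_le.
have := central `|x|%N y.+1; rewrite /E.
have -> : ((n - 1) %% 2)%N%:Z = 0 by lia.
rewrite subr0 gez0_abs; last by lia.
by apply => //; lia.
Qed.

(** For even [n], the central minors with [x + y] odd are those on arcs that start
    at opposite points.
    Exchanging the arcs moves [a] by [h = n / 2], so half a turn is enough. *)
Lemma arc_minors_pos_even (R : realFieldType) (m : int -> int -> R) (h : nat) :
  (0 < h)%N ->
  (forall i j, m i j = m j i) -> (forall i j, m i (j + h.*2%:Z) = m i j) ->
  central_minors_pos m h.*2 -> arc_minors_pos m h.*2 h.
Proof.
move=> h_gt0 m_sym m_per central a [|y] le_y _; first by rewrite arc_minor0.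
set n := h.*2 in m_per central.
(* The least a for which x = 2 a + 1 + (y + 1) is at least 1. *)
pose s : int := - (y.+1%:Z %/ 2)%Z.
pose P (a : int) := 0 < arc_minor m a (a + h%:Z) y.+1.
apply: (@int_periodic_ind h s P) => // [{}a|{}a ge_a lt_a]; rewrite /P.
  suff -> : arc_minor m (a + h%:Z) (a + h%:Z + h%:Z) y.+1 =
            arc_minor m a (a + h%:Z) y.+1 by [].
  have -> : a + h%:Z + h%:Z = a + n%:Z by lia.
  by rewrite (arc_minor_per _ _ _ m_per) arc_minorC.
have := central `|(2 * a + 1 + y.+1%:Z)%R|%N y.+1.
have -> : ((n - 1) %% 2)%N%:Z = 1 by lia.
rewrite gez0_abs; last by lia.
have -> : ((2 * a + 1 + y.+1%:Z - y.+1%:Z) %/ 2)%Z = a by lia.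
have -> : ((2 * a + 1 + y.+1%:Z - y.+1%:Z + n%:Z - 1) %/ 2)%Z = a + h%:Z by lia.
by apply=> //; lia.
Qed.

(** For even [n], the central minors with [x + y] even have gap [n / 2 - 1], but
    [a] covers half a turn only.  The condensation whose left-hand side has the
    gaps [n / 2 + 1] and [n / 2 - 1] supplies the other half: after an exchange
    of arcs both factors have gap [n / 2 - 1], at points half a turn apart, and
    their product is positive by [arc_minors_pos_even]. *)
Lemma arc_minors_pos_even_pred (R : realFieldType) (m : int -> int -> R) (h : nat) :
  (forall i j, m i j = m j i) -> (forall i j, m i (j + h.+1.*2%:Z) = m i j) ->
  central_minors_pos m h.+1.*2 -> arc_minors_pos m h.+1.*2 h.
Proof.
move=> m_sym m_per central a [|y] le_y _; first by rewrite arc_minor0.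
have mid := arc_minors_pos_even (ltn0Sn h) m_sym m_per central.
set n := h.+1.*2 in m_per central mid.
(* The least a for which x = 2 a + (y + 1) is at least 1. *)
pose s : int := - (y%:Z %/ 2)%Z.
pose P (a : int) := 0 < arc_minor m a (a + h%:Z) y.+1.
apply: (@int_periodic_ind h.+1 s P) => // [{}a|{}a ge_a lt_a]; rewrite /P.
  have : 0 < arc_minor m (a + h.+1%:Z) (a + h.+1%:Z + h%:Z) y.+1 *
             arc_minor m a (a + h%:Z) y.+1.
    have -> : arc_minor m (a + h.+1%:Z) (a + h.+1%:Z + h%:Z) y.+1 =
              arc_minor m (a - 1) (a + h%:Z + 1) y.+1.
      have -> : a + h.+1%:Z + h%:Z = a - 1 + n%:Z by lia.
      rewrite (arc_minor_per _ _ _ m_per) arc_minorC //; congr arc_minor.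
      by lia.
    have := arc_minor_dodgson m (a - 1) (a + h%:Z) y; rewrite subrK => ->.
    have -> : a + h%:Z + 1 = a + h.+1%:Z by lia.
    have -> : a + h%:Z = a - 1 + h.+1%:Z by lia.
    by rewrite addr_gt0 ?mulr_gt0 ?mid //; lia.
  move=> prod_gt0; split=> pos; first by rewrite -(pmulr_lgt0 _ pos).
  by rewrite -(pmulr_rgt0 _ pos).
have := central `|(2 * a + y.+1%:Z)%R|%N y.+1.
have -> : ((n - 1) %% 2)%N%:Z = 1 by lia.
rewrite gez0_abs; last by lia.
have -> : ((2 * a + y.+1%:Z - y.+1%:Z) %/ 2)%Z = a by lia.
have -> : ((2 * a + y.+1%:Z - y.+1%:Z + n%:Z - 1) %/ 2)%Z = a + h%:Z by lia.
by apply=> //; lia.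
Qed.

Lemma arc_minors_gt0 (R : realFieldType) (m : int -> int -> R) (n : nat) :
  (0 < n)%N -> (forall i j, m i j = m j i) ->
  (forall i j, m i (j + n%:Z) = m i j) -> central_minors_pos m n ->
  forall d, (d <= n)%N -> arc_minors_pos m n d.
Proof.
move=> n_gt0 m_sym m_per central.
have [h [le_h [le_n [pos0 pos1]]]] : exists h, (h.*2 <= n)%N /\
    (n <= h.+1.*2)%N /\ arc_minors_pos m n h /\ arc_minors_pos m n h.+1.
  move: (odd_double_half n) m_per central n_gt0.
  case: (odd n) (n./2) => h <-; rewrite ?add1n ?add0n => m_per central n_gt0.
    have pos0 := arc_minors_pos_odd m_sym m_per central; exists h.
    have := arc_minors_posC m_sym m_per _ pos0.
    have -> : (h.*2.+1 - h = h.+1)%N by lia.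
    by move=> pos1; do !split=> //; apply: pos1; lia.
  case: h => // h in m_per central n_gt0 *.
  have pos0 := arc_minors_pos_even_pred m_sym m_per central.
  have pos1 := arc_minors_pos_even (ltn0Sn h) m_sym m_per central.
  by exists h; do !split=> //; lia.
have outer d : arc_minors_pos m n (h + d) /\ arc_minors_pos m n (h + d.+1).
  elim: d => [|d [IH0 IH1]]; first by rewrite addn0 addn1.
  by split=> //; rewrite !addnS in IH1 *; apply: arc_minors_pos_step => //; lia.
move=> d le_d.
have [le_hd|lt_dh] := leqP h d.
  by rewrite -(subnKC le_hd); case: (outer (d - h)%N).
rewrite -(subKn le_d); apply: arc_minors_posC => //; first exact: leq_subr.
have le_hd : (h <= n - d)%N by lia.
by rewrite -(subnKC le_hd); case: (outer (n - d - h)%N).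
Qed.

(** * The response matrix as a Schur complement *)

Definition kirchhoff (R : realType) (n : nat) (G : network R n)
    (v w : vertex G) : R :=
  (v == w)%:R * (\sum_u cond v u) - cond v w.

Lemma condC (R : realType) (n : nat) (G : network R n) (v w : vertex G) :
  cond v w = cond w v.
Proof. by apply: eq_bigl => e; rewrite /joins orbC. Qed.

Lemma kirchhoffC (R : realType) (n : nat) (G : network R n) (v w : vertex G) :
  kirchhoff v w = kirchhoff w v.
Proof.
rewrite /kirchhoff condC eq_sym; congr (_ - _).
by have [->|] := eqVneq w v; rewrite ?mul0r.
Qed.

Lemma cond0 (R : realType) (n : nat) (G : network R n) (v w : vertex G) :
  ~~ adj v w -> cond v w = 0.
Proof.
rewrite negb_exists => /forallP nadj; rewrite /cond big_pred0 // => e.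
exact: negbTE.
Qed.

Lemma cond_ge0 (R : realType) (n : nat) (G : network R n) (v w : vertex G) :
  0 <= cond v w.
Proof. by apply: sumr_ge0 => e _; apply/ltW/conductance_gt0. Qed.

Lemma cond_gt0 (R : realType) (n : nat) (G : network R n) (v w : vertex G) :
  adj v w -> 0 < cond v w.
Proof.
case/existsP => e evw; rewrite /cond (bigD1 e) //=.
rewrite ltr_pwDl ?conductance_gt0 //; apply: sumr_ge0 => e' _.
exact/ltW/conductance_gt0.
Qed.

Lemma kirchhoff_adj (R : realType) (n : nat) (G : network R n) (v w : vertex G) :
  kirchhoff v w != 0 -> v != w -> adj v w.
Proof.
move=> K0 /negPf vw; apply: contraR K0 => /cond0.
by rewrite /kirchhoff vw mul0r => ->; rewrite subr0.
Qed.

Lemma laplacian_cond (R : realType) (n : nat) (G : network R n)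
    (f : vertex G -> R) (v : vertex G) :
  laplacian f v = \sum_w cond v w * (f v - f w).
Proof.
rewrite /laplacian big_mkcond; apply: eq_bigr => w _.
by case: ifPn => // /cond0 ->; rewrite mul0r.
Qed.

Lemma laplacianE (R : realType) (n : nat) (G : network R n)
    (f : vertex G -> R) (v : vertex G) :
  laplacian f v = \sum_w kirchhoff v w * f w.
Proof.
rewrite laplacian_cond /kirchhoff.
under [RHS]eq_bigr do rewrite mulrBl.
under [LHS]eq_bigr do rewrite mulrBr.
rewrite !sumrB; congr (_ - _); rewrite [RHS](bigD1 v) //= [X in _ + X]big1 => [|w].
  by rewrite eqxx mul1r addr0 mulr_suml.
by rewrite eq_sym => /negPf ->; rewrite !mul0r.
Qed.

Lemma dirichlet_energy (R : realType) (n : nat) (G : network R n)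
    (f : vertex G -> R) :
  (\sum_v f v * laplacian f v) *+ 2 = \sum_v \sum_w cond v w * (f v - f w) ^+ 2.
Proof.
have E : \sum_v f v * laplacian f v =
    \sum_v \sum_w cond v w * (f v * (f v - f w)).
  apply: eq_bigr => v _; rewrite laplacian_cond mulr_sumr.
  by apply: eq_bigr => w _; ring.
rewrite mulr2n {1}E E [X in X + _]exchange_big /= -big_split /=.
apply: eq_bigr => v _.
rewrite -big_split /=; apply: eq_bigr => w _.
by rewrite (condC w v); ring.
Qed.

(** A harmonic function that vanishes at the nodes has zero energy, hence is
    constant on every component, and every component has a node. *)
Lemma harmonic0 (R : realType) (n : nat) (G : network R n) (f : vertex G -> R) :
  is_harmonic_extension (fun=> 0) f -> forall v, f v = 0.
Proof.
move=> [f0 lap0] v.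
have energy0 : \sum_v \sum_w cond v w * (f v - f w) ^+ 2 = 0.
  rewrite -dirichlet_energy big1 ?mul0rn // => w _.
  have [/codomP[i ->]|/lap0 ->] := boolP (w \in codom (node G)).
    by rewrite f0 mul0r.
  by rewrite mulr0.
have term_ge0 x y : 0 <= cond x y * (f x - f y) ^+ 2.
  by rewrite mulr_ge0 ?cond_ge0 ?sqr_ge0.
have adj_eq x y : adj x y -> f x = f y.
  move=> xy; have sum_ge0 z : 0 <= \sum_w cond z w * (f z - f w) ^+ 2.
    by apply: sumr_ge0 => w _.
  have /psumr_eq0P Ex := energy0.
  have {Ex}/psumr_eq0P Ex := Ex (fun z _ => sum_ge0 z) x isT.
  have /eqP := Ex (fun w _ => term_ge0 x w) y isT.
  by rewrite mulf_eq0 gt_eqF ?cond_gt0 //= sqrf_eq0 subr_eq0 => /eqP.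
have [i /connectP[p]] := component_has_node v.
elim: p v => [|w p IHp] v /=; first by move=> _ <-; rewrite f0.
by case/andP => /adj_eq -> wp /(IHp _ wp).
Qed.

Definition nonnode (R : realType) (n : nat) (G : network R n) :
    {pred vertex G} :=
  [pred v | v \notin codom (node G)].

Arguments nonnode {R n} G _.

(** A numbering of the vertices that are not nodes, to use them as row and
    column indices of matrices. *)
Definition inner (R : realType) (n : nat) (G : network R n)
  (j : 'I_#|nonnode G|) : vertex G := enum_val j.

Lemma inner_inj (R : realType) (n : nat) (G : network R n) :
  injective (@inner _ _ G).
Proof. exact: enum_val_inj. Qed.

Lemma inner_notin (R : realType) (n : nat) (G : network R n) j :
  inner j \notin codom (node G).
Proof. exact: (enum_valP j). Qed.

Lemma inner_surj (R : realType) (n : nat) (G : network R n) (v : vertex G) :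
  v \notin codom (node G) -> exists j, v = inner j.
Proof.
move=> v_notin; have v_in : v \in nonnode G by [].
by exists (enum_rank_in v_in v); rewrite /inner enum_rankK_in.
Qed.

Lemma inner_neq_node (R : realType) (n : nat) (G : network R n) j i :
  (inner j == node G i) = false.
Proof. by apply: contraNF (inner_notin j) => /eqP ->; apply: codom_f. Qed.

Lemma sum_vertex (R : realType) (n : nat) (G : network R n) (F : vertex G -> R) :
  \sum_v F v = \sum_i F (node G i) + \sum_j F (@inner _ _ G j).
Proof.
rewrite (bigID (mem (codom (node G)))) /=; congr (_ + _); last first.
  by rewrite -(big_enum_val F).
rewrite -(big_imset _ (in2W (@node_inj _ _ G))) /=; apply: eq_bigl => v.
by apply/codomP/imsetP => [[i ->]|[i _ ->]]; [exists i|exists i].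
Qed.

Definition glue (R : realType) (n : nat) (G : network R n) (u : 'I_n -> R)
    (h : 'I_#|nonnode G| -> R) (v : vertex G) : R :=
  \sum_i u i * (v == node G i)%:R + \sum_j h j * (v == inner j)%:R.

Lemma sum_delta (R : realType) (T : finType) (F : T -> R) (x : T) :
  \sum_y F y * (x == y)%:R = F x.
Proof.
rewrite (bigD1 x) //= eqxx mulr1 big1 ?addr0 // => y.
by rewrite eq_sym => /negPf ->; rewrite mulr0.
Qed.

Lemma glue_node (R : realType) (n : nat) (G : network R n) (u : 'I_n -> R)
  (h : 'I_#|nonnode G| -> R) i : glue u h (node G i) = u i.
Proof.
rewrite /glue [X in _ + X]big1 => [|j _]; last first.
  by rewrite eq_sym inner_neq_node mulr0.
rewrite addr0; under eq_bigr do rewrite (inj_eq (@node_inj _ _ G)).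
exact: sum_delta.
Qed.

Lemma glue_inner (R : realType) (n : nat) (G : network R n) (u : 'I_n -> R)
  (h : 'I_#|nonnode G| -> R) j : glue u h (inner j) = h j.
Proof.
rewrite /glue [X in X + _]big1 => [|i _]; last first.
  by rewrite inner_neq_node mulr0.
rewrite add0r; under eq_bigr do rewrite (inj_eq (@inner_inj _ _ G)).
exact: sum_delta.
Qed.

Lemma laplacian_glue (R : realType) (n : nat) (G : network R n)
  (u : 'I_n -> R) (h : 'I_#|nonnode G| -> R) v :
  laplacian (glue u h) v = \sum_i kirchhoff v (node G i) * u i +
    \sum_j kirchhoff v (inner j) * h j.
Proof.
rewrite laplacianE sum_vertex.
by congr (_ + _); apply: eq_bigr => i _; rewrite ?glue_node ?glue_inner.
Qed.

Definition kirchhoff_inner (R : realType) (n : nat) (G : network R n) :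
  'M[R]_#|nonnode G| := \matrix_(i, j) kirchhoff (inner i) (inner j).

(** A vector in the kernel is a harmonic function that vanishes at the nodes. *)
Lemma kirchhoff_inner_unit (R : realType) (n : nat) (G : network R n) :
  kirchhoff_inner G \in unitmx.
Proof.
rewrite -row_free_unit; apply: inj_row_free => x xK0.
apply/rowP => j; rewrite mxE -(glue_inner (fun=> 0) (x 0)).
apply: harmonic0; split=> [i|v v_int]; first exact: glue_node.
have {v_int} [i ->] := inner_surj v_int.
rewrite laplacian_glue big1 ?add0r => [|i' _]; last by rewrite mulr0.
have /rowP/(_ i) := xK0; rewrite !mxE => xKi0; rewrite -[RHS]xKi0.
by apply: eq_bigr => i' _; rewrite mxE kirchhoffC mulrC.
Qed.

Lemma harmonic_extensionP (R : realType) (n : nat) (G : network R n)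
    (u : 'I_n -> R) :
  is_harmonic_extension u (@harmonic_extension _ _ G u).
Proof.
pose b : 'cV[R]_#|nonnode G| := \col_j \sum_i kirchhoff (inner j) (node G i) * u i.
pose h := - (invmx (kirchhoff_inner G) *m b).
suff : is_harmonic_extension u (glue u (fun j => h j 0)).
  by move=> hf; apply: (xgetPex (fun=> 0)); exists (glue u (fun j => h j 0)).
split=> [i|v v_int]; first exact: glue_node.
have {v_int} [i ->] := inner_surj v_int.
have /colP/(_ i) : kirchhoff_inner G *m h = - b.
  by rewrite mulmxN mulKVmx ?kirchhoff_inner_unit.
rewrite !mxE laplacian_glue => hi; apply/eqP; rewrite addrC addr_eq0 -hi.
by apply/eqP/eq_bigr => j _; rewrite [kirchhoff_inner _ _ _]mxE.
Qed.

Arguments harmonic_extensionP {R n} G u.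

Lemma response_matrixE (R : realType) (n : nat) (G : network R n) i j :
  response_matrix G i j =
  - laplacian (@harmonic_extension _ _ G (fun k => (k == j)%:R)) (node G i).
Proof. by rewrite mxE. Qed.

(** Green's identity: both entries are, up to sign, the value of the Dirichlet
    form at the harmonic extensions of two indicator functions. *)
Lemma response_matrixC (R : realType) (n : nat) (G : network R n) i j :
  response_matrix G i j = response_matrix G j i.
Proof.
pose e (j : 'I_n) := @harmonic_extension _ _ G (fun k => (k == j)%:R).
have green i' j' : laplacian (e j') (node G i') = \sum_v e i' v * laplacian (e j') v.
  have [ei' _] := harmonic_extensionP G (fun k => (k == i')%:R).
  have [_ ej'] := harmonic_extensionP G (fun k => (k == j')%:R).
  rewrite sum_vertex [X in _ + X]big1 => [|k _]; last first.
    by rewrite ej' ?mulr0 ?inner_notin.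
  under eq_bigr => k _ do rewrite /e ei' eq_sym mulrC.
  by rewrite addr0 sum_delta.
rewrite !response_matrixE -/(e i) -/(e j) !green; congr (- _).
under eq_bigr => v _ do rewrite laplacianE mulr_sumr.
rewrite exchange_big /=; apply: eq_bigr => v _; rewrite laplacianE mulr_sumr.
by apply: eq_bigr => w _; rewrite (kirchhoffC w v); ring.
Qed.

(** * From a nonzero minor to disjoint paths *)

(** The index set A + I, where A is the image of [a] and I consists of the
    vertices that are not nodes. *)
Definition end_or_inner (R : realType) (n : nat) (G : network R n) (k : nat)
    (a : 'I_k -> 'I_n) (i : 'I_(k + #|nonnode G|)) : vertex G :=
  match fintype.split i with inl i' => node G (a i') | inr j => inner j end.

Lemma laplacian_node (R : realType) (n : nat) (G : network R n)
    (f : vertex G -> R) (b : 'I_n) (v : vertex G) :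
  is_harmonic_extension (fun k => (k == b)%:R) f ->
  laplacian f v =
    kirchhoff v (node G b) + \sum_j kirchhoff v (inner j) * f (inner j).
Proof.
move=> [f_node _]; rewrite laplacianE sum_vertex; congr (_ + _).
rewrite -[RHS](sum_delta (fun k => kirchhoff v (node G k))).
by apply: eq_bigr => i _; rewrite f_node eq_sym.
Qed.

(** Column elimination: the entries of [H] are the values at the inner vertices
    of the harmonic extensions of the indicators of the [b j].  Adding to each
    of the first columns the combination of the inner columns given by [H]
    turns the upper left block into minus a submatrix of the response matrix, and
    makes the lower left block vanish by harmonicity. *)
Lemma det_kirchhoff (R : realType) (n : nat) (G : network R n) (k : nat)
    (a b : 'I_k -> 'I_n) :
  \det (\matrix_(i, j) response_matrix G (a i) (b j)) != 0 ->
  \det (\matrix_(i, j) kirchhoff (@end_or_inner _ _ G _ a i)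
                                 (@end_or_inner _ _ G _ b j)) != 0.
Proof.
set L := \matrix_(i, j) _; set K := \matrix_(i, j) _ => L0.
pose f (b : 'I_n) := @harmonic_extension _ _ G (fun k => (k == b)%:R).
pose KAI : 'M[R]_(k, #|nonnode G|) :=
  \matrix_(i, j) kirchhoff (node G (a i)) (inner j).
pose H : 'M[R]_(#|nonnode G|, k) := \matrix_(i, j) f (b j) (inner i).
have elim : K *m block_mx 1%:M 0 H 1%:M = block_mx (- L) KAI 0 (kirchhoff_inner G).
  have -> : K = block_mx (\matrix_(i, j) kirchhoff (node G (a i)) (node G (b j)))
      KAI (\matrix_(i, j) kirchhoff (inner i) (node G (b j))) (kirchhoff_inner G).
    apply/matrixP => i j; rewrite /block_mx !mxE /end_or_inner.
    by case: (fintype.split i) => i'; rewrite !mxE;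
       case: (fintype.split j) => j'; rewrite !mxE.
  rewrite mulmx_block !mulmx1 !mulmx0 !add0r; congr block_mx.
    apply/matrixP => i j; rewrite !mxE /response opprK.
    rewrite (laplacian_node _ (harmonic_extensionP G _)); congr (_ + _).
    by apply: eq_bigr => l _; rewrite !mxE.
  apply/matrixP => i j; rewrite !mxE.
  have f_harm := harmonic_extensionP G (fun k => (k == b j)%:R).
  rewrite -[RHS](proj2 f_harm _ (inner_notin i)) (laplacian_node _ f_harm).
  by congr (_ + _); apply: eq_bigr => l _; rewrite !mxE.
have := congr1 determinant elim.
rewrite det_mulmx det_lblock det_ublock !det1 !mulr1 => ->.
rewrite -scaleN1r detZ !mulf_neq0 ?expf_neq0 ?oppr_eq0 ?oner_neq0 //.
by rewrite -unitfE -unitmxE kirchhoff_inner_unit.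
Qed.

Lemma det_neq0_perm (R : comNzRingType) (k : nat) (A : 'M[R]_k) :
  \det A != 0 -> exists s : {perm 'I_k}, forall i, A i (s i) != 0.
Proof.
move=> detA; apply: contrapT => no_perm; case/negP: detA; apply/eqP.
rewrite /determinant big1 // => s _.
have [i /eqP Ai0] : exists i, A i (s i) == 0.
  apply: contrapT => no_i; apply: no_perm; exists s => i.
  by apply/negP => Ai0; apply: no_i; exists i.
by rewrite (bigD1 i) //= Ai0 mul0r mulr0.
Qed.

Lemma end_or_inner_inj (R : realType) (n : nat) (G : network R n) (k : nat)
    (a : 'I_k -> 'I_n) : injective a -> injective (@end_or_inner _ _ G _ a).
Proof.
move=> a_inj i j; rewrite /end_or_inner.
case: fintype.splitP => i' iE; case: fintype.splitP => j' jE.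
- by move=> /(@node_inj _ _ G)/a_inj ij; apply/val_inj; rewrite /= iE jE ij.
- by move/eqP; rewrite eq_sym inner_neq_node.
- by move/eqP; rewrite inner_neq_node.
- by move=> /inner_inj ij; apply/val_inj; rewrite /= iE jE ij.
Qed.

Lemma end_or_inner_lshift (R : realType) (n : nat) (G : network R n) (k : nat)
    (a : 'I_k -> 'I_n) (x : 'I_k) :
  end_or_inner a (lshift #|nonnode G| x) = node G (a x).
Proof. by rewrite /end_or_inner (unsplitK (inl x)). Qed.

(** An index below [k] stands for the node [a i] as a row and for [b i] as a
    column, the other indices for the same inner vertex in both roles.  The path
    from [a x] follows the orbit of [x] under [s] until it first comes back to
    an index below [k], which is read as a column: its vertices are the
    [ra (orb t x)] for [t <= N x], and then the node [b (fin x)]. *)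
Lemma disjointly_connected_of_perm (R : realType) (n : nat) (G : network R n)
    (k : nat) (a b : 'I_k -> 'I_n) (s : {perm 'I_(k + #|nonnode G|)}) :
  injective a -> injective b -> (forall i j, a i != b j) ->
  (forall i, kirchhoff (@end_or_inner _ _ G _ a i)
                       (@end_or_inner _ _ G _ b (s i)) != 0) ->
  disjointly_connected G [set a i | i : 'I_k] [set b i | i : 'I_k].
Proof.
move=> a_inj b_inj ab s_edge.
set m := #|nonnode G| in s s_edge.
pose ra := @end_or_inner _ _ G _ a; pose cb := @end_or_inner _ _ G _ b.
pose start (x : 'I_k) : 'I_(k + m) := lshift m x.
pose orb t (x : 'I_k) := iter t s (start x).
have inner_same (i : 'I_(k + m)) : (k <= i)%N -> ra i = cb i.
  rewrite /ra /cb /end_or_inner; case: fintype.splitP => // j ->.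
  by rewrite leqNgt ltn_ord.
have ra_inj : injective ra by exact: end_or_inner_inj.
have cb_inj : injective cb by exact: end_or_inner_inj.
have ra_cb (i j : 'I_(k + m)) : ra i = cb j -> i = j /\ (k <= i)%N.
  rewrite /ra /cb /end_or_inner.
  case: fintype.splitP => i' iE; case: fintype.splitP => j' jE.
  - by move=> /(@node_inj _ _ G)/eqP; rewrite (negPf (ab _ _)).
  - by move/eqP; rewrite eq_sym inner_neq_node.
  - by move/eqP; rewrite inner_neq_node.
  - move=> /inner_inj ij; split; last by rewrite iE leq_addr.
    by apply/val_inj; rewrite /= iE jE ij.
have returns x : exists t, (orb t.+1 x < k)%N.
  have [t] : exists t, iter t.+1 s (start x) = start x.
    exists #[s]%g.-1; rewrite prednK ?order_gt0 //.
    by rewrite -permX expg_order perm1.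
  by move=> xE; exists t; rewrite /orb xE /= ltn_ord.
pose N x := ex_minn (returns x).
have N_left x : (orb (N x).+1 x < k)%N by rewrite /N; case: ex_minnP.
have N_right x t : (0 < t <= N x)%N -> (k <= orb t x)%N.
  rewrite /N; case: ex_minnP => l _ l_min; case: t => // t /= le_t.
  by rewrite leqNgt; apply/negP => /l_min; rewrite leqNgt le_t.
have orbD t u x : orb (t + u) x = iter t s (orb u x) by rewrite /orb iterD.
have iter_inj t : injective (iter t s).
  by elim: t => // t IHt i j /perm_inj/IHt.
(* If two orbits meet, undo s: the one that took fewer steps is at its start,
   below k, so that the other one is back below k, which is too early unless
   both took the same number of steps. *)
have collide_le x y t u : (u <= N y)%N -> (t <= u)%N ->
    orb t x = orb u y -> t = u /\ x = y.
  move=> le_u le_tu; rewrite -(subnKC le_tu) orbD => /iter_inj xE.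
  have [ut|] := posnP (u - t).
    by split; [lia|apply: (@lshift_inj _ m); rewrite -/(start x) [LHS]xE ut].
  move=> gt0; have := N_right y (u - t)%N; rewrite -xE /= gt0.
  rewrite (leq_trans (leq_subr t u) le_u) => /(_ isT).
  by rewrite /= leqNgt ltn_ord.
have collide x y t u : (t <= N x)%N -> (u <= N y)%N ->
    orb t x = orb u y -> t = u /\ x = y.
  move=> le_t le_u xy; have [le_tu|/ltnW le_ut] := leqP t u.
    exact: collide_le le_u le_tu xy.
  by have [-> ->] := collide_le _ _ _ _ le_t le_ut (esym xy).
(* A diagonal entry of the Laplacian does not give an edge, but it would be used
   only at a fixed point of s; the orbit would then be constant, at an index
   below k, which stands for different vertices as a row and as a column. *)
have edge x t : (t <= N x)%N -> adj (ra (orb t x)) (cb (orb t.+1 x)).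
  move=> le_t; apply: kirchhoff_adj; first exact: s_edge.
  apply/eqP => /ra_cb[]; rewrite /orb iterSr => /iter_inj fixed.
  have -> : iter t s (start x) = start x.
    by elim: (t) => //= l ->; rewrite -fixed.
  by rewrite /= leqNgt ltn_ord.
pose fin x := Ordinal (N_left x).
have finE x : orb (N x).+1 x = start (fin x) by apply/val_inj.
have fin_inj : injective fin.
  move=> x y xy; have /perm_inj/collide : orb (N x).+1 x = orb (N y).+1 y.
    by rewrite !finE xy.
  by case.
pose vert x t := if (t <= N x)%N then ra (orb t x) else node G (b (fin x)).
have vert_inj x y t u : (t <= (N x).+1)%N -> (u <= (N y).+1)%N ->
    vert x t = vert y u -> t = u /\ x = y.
  have endE z : node G (b (fin z)) = cb (start (fin z)).
    by rewrite /cb end_or_inner_lshift.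
  have far z w l : ra (orb l z) <> node G (b (fin w)).
    by rewrite endE => /ra_cb[->]; rewrite /= leqNgt N_left.
  rewrite /vert; have [le_t _|lt_t le_t] := leqP t (N x);
    have [le_u _|lt_u le_u] := leqP u (N y).
  - by move/ra_inj/collide; apply.
  - by move/far.
  - by move/esym/far.
  - rewrite !endE => /cb_inj; rewrite -!finE => /perm_inj/collide[]//.
    by move=> NN xy; split=> //; lia.
pose p x := [seq cb (orb t.+1 x) | t <- iota 0 (N x).+1].
have nth_path x t v0 : (t <= (N x).+1)%N ->
    nth v0 (node G (a x) :: p x) t = vert x t.
  case: t => [_|t le_t] /=.
    by rewrite /vert leq0n /ra /orb /= end_or_inner_lshift.
  rewrite (nth_map 0%N) ?size_iota // nth_iota // add0n /vert.
  case: ifP => [lt_t|/negbT le_N]; first exact/esym/inner_same/N_right.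
  have -> : t = N x by lia.
  by rewrite finE /cb end_or_inner_lshift.
have size_p x : size (p x) = (N x).+1 by rewrite size_map size_iota.
pose b' i := if [pick x | a x == i] is Some x then b (fin x) else i.
pose p' i := if [pick x | a x == i] is Some x then p x else [::].
have pick_a x : [pick y | a y == a x] = Some x.
  by case: pickP => [y /eqP/a_inj->|/(_ x)/eqP].
have b'E x : b' (a x) = b (fin x) by rewrite /b' pick_a.
have p'E x : p' (a x) = p x by rewrite /p' pick_a.
exists b', p'; split.
- have [g finK gK] := injF_bij fin_inj.
  apply/setP => i; apply/imsetP/imsetP.
    by move=> [_ /imsetP[x _ ->] ->]; exists (fin x).
  move=> [y _ ->]; exists (a (g y)); first exact: imset_f.
  by rewrite b'E gK.
- move=> _ /imsetP[x _ ->]; rewrite b'E p'E; split.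
  + apply/(pathP (node G (a x))) => t; rewrite size_p => lt_t.
    rewrite nth_path ?(ltnW lt_t) // (nth_map 0%N) ?size_iota // nth_iota //.
    by rewrite /vert ifT //; apply: edge.
  + apply/(uniqP (node G (a x))) => t u.
    rewrite !inE -[size _]/(size (p x)).+1 size_p => lt_t lt_u.
    by rewrite !nth_path // => /vert_inj[].
  + by rewrite (last_nth (node G (a x))) size_p nth_path // /vert ltnn.
  + move=> i /(nthP (node G (a x)))[t].
    rewrite -[size _]/(size (p _)).+1 size_p => lt_t.
    rewrite nth_path // /vert; case: leqP => [le_t|_]; last first.
      by move/(@node_inj _ _ G); right.
    case: t => [|t] in lt_t le_t *.
      by rewrite /ra end_or_inner_lshift => /(@node_inj _ _ G); left.
    have := N_right x t.+1 le_t; rewrite /ra /end_or_inner.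
    case: fintype.splitP => [j ->|j _ _ /eqP]; first by rewrite leqNgt ltn_ord.
    by rewrite inner_neq_node.
- move=> _ _ /imsetP[x _ ->] /imsetP[y _ ->] xy; rewrite !p'E.
  rewrite disjoint_subset; apply/fintype.subsetP => v.
  move=> /(nthP (node G (a x)))[t]; rewrite -[size _]/(size (p _)).+1 size_p => lt_t.
  rewrite nth_path // => <-; rewrite inE; apply/negP.
  move=> /(nthP (node G (a x)))[u]; rewrite -[size _]/(size (p _)).+1 size_p => lt_u.
  rewrite nth_path // => /vert_inj[]// _ yx.
  by rewrite yx eqxx in xy.
Qed.

(** * Coordinates along two disjoint arcs *)

Lemma cyc_addn (n : nat) (n_gt0 : (0 < n)%N) (z : int) :
  cyc n_gt0 (z + n%:Z) = cyc n_gt0 z.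
Proof. by apply/val_inj => /=; rewrite modzDr. Qed.

Lemma cyc_inj (n : nat) (n_gt0 : (0 < n)%N) (z w : int) :
  `|z - w|%R < n%:Z -> cyc n_gt0 z = cyc n_gt0 w -> z = w.
Proof.
move=> zw /(congr1 val) /=; have n0 : n%:Z != 0 by lia.
have := modz_ge0 z n0; have := modz_ge0 w n0.
have := divz_eq z n%:Z; have := divz_eq w n%:Z.
set q := (w %/ _)%Z; set q' := (z %/ _)%Z; set r := (w %% _)%Z.
set r' := (z %% _)%Z => wE zE r_ge0 r'_ge0 rr.
have [qq|[qq|qq]] : q' = q \/ 1 <= q' - q \/ q' - q <= -1 by lia.
- by rewrite zE wE qq; lia.
- by have : n%:Z <= (q' - q) * n%:Z; [rewrite ler_peMl|]; lia.
- by have : n%:Z <= (q - q') * n%:Z; [rewrite ler_peMl|]; lia.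
Qed.

Lemma cyc_nat (n : nat) (n_gt0 : (0 < n)%N) (i : 'I_n) (t : nat) :
  i = t %[mod n] -> cyc n_gt0 t%:Z = i.
Proof.
move=> it; apply/val_inj => /=; rewrite modz_nat absz_nat -it.
by rewrite modn_small.
Qed.

Lemma cyclic_intervalP (n : nat) (n_gt0 : (0 < n)%N) (s l : nat) (i : 'I_n) :
  reflect (exists2 t, (t < l)%N & i = cyc n_gt0 (s%:Z + t%:Z))
          (i \in cyclic_interval n s l).
Proof.
rewrite inE; apply: (iffP existsP) => [[t /eqP it]|[t lt_t ->]].
  by exists t => //; rewrite -PoszD (cyc_nat _ it).
exists (Ordinal lt_t) => /=; rewrite -PoszD modz_nat absz_nat.
by rewrite modn_mod.
Qed.

(** [g] numbers an arc that contains [A]; listing the positions of the elements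
    of [A] in increasing order makes the results on [minor] applicable. *)
Lemma coordinates (n l k : nat) (g : nat -> 'I_n) (A : {set 'I_n}) :
  {in [pred t | (t < l)%N] &, injective g} ->
  (forall i, i \in A -> exists2 t, (t < l)%N & i = g t) -> #|A| = k ->
  exists r, [/\ sorted ltn r, all (ltn^~ l) r, size r = k,
    injective (fun x : 'I_k => g (nth 0%N r x)) &
    [set g (nth 0%N r x) | x : 'I_k] = A].
Proof.
move=> g_inj g_onto cardA; pose r := [seq t <- iota 0 l | g t \in A].
have r_lt t : t \in r -> (t < l)%N by rewrite mem_filter mem_iota => /and3P[].
have r_uniq : uniq (map g r).
  rewrite map_inj_in_uniq ?filter_uniq ?iota_uniq //.
  by move=> t u /r_lt t_lt /r_lt u_lt; apply: g_inj.
have rA : map g r =i A.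
  move=> i; apply/mapP/idP => [[t + ->]|iA].
    by rewrite mem_filter => /andP[].
  have [t lt_t iE] := g_onto i iA; exists t => //.
  by rewrite mem_filter mem_iota -iE iA.
have szr : size r = k.
  by rewrite -cardA -(eq_card rA) (card_uniqP r_uniq) size_map.
have r_nth (x : 'I_k) : nth 0%N r x \in r by rewrite mem_nth ?szr.
exists r; split=> //.
- by apply: sorted_filter; [exact: ltn_trans|exact: iota_ltn_sorted].
- by apply/allP => t /r_lt.
- move=> x y /g_inj; rewrite !inE !r_lt // => /(_ isT isT)/eqP.
  by rewrite nth_uniq ?szr ?filter_uniq ?iota_uniq // => /eqP/val_inj.
- apply/setP => i; rewrite -rA; apply/imsetP/mapP.
    by move=> [x _ ->]; exists (nth 0%N r x).
  move=> [t tr ->]; have t_ix : (index t r < k)%N by rewrite -szr index_mem.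
  by exists (Ordinal t_ix) => //=; rewrite nth_index.
Qed.

(** The starting point of the second interval lies [d] steps after that of the
    first one; [s' - s] reduced modulo [n] is such a [d], for otherwise one of
    the two starting points would lie in both intervals. *)
Lemma disjoint_intervals (n : nat) (n_gt0 : (0 < n)%N) (s l s' l' : nat) :
  (0 < l)%N -> (0 < l')%N ->
  [disjoint cyclic_interval n s l & cyclic_interval n s' l'] ->
  exists d, [/\ (l <= d)%N, (d + l' <= n)%N &
    forall z, cyc n_gt0 (s'%:Z + z) = cyc n_gt0 (s%:Z + d%:Z + z)].
Proof.
move=> l_gt0 l'_gt0 disj; have n0 : n%:Z != 0 by lia.
have no_common t t' : (t < l)%N -> (t' < l')%N ->
    cyc n_gt0 (s%:Z + t%:Z) <> cyc n_gt0 (s'%:Z + t'%:Z).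
  move=> lt_t lt_t' eq_i.
  have /(disjointFr disj)/negP[] :
      cyc n_gt0 (s%:Z + t%:Z) \in cyclic_interval n s l.
    by apply/(cyclic_intervalP n_gt0); exists t.
  by apply/(cyclic_intervalP n_gt0); exists t'.
pose d := `|((s'%:Z - s%:Z) %% n%:Z)%Z|%N.
have dE : d%:Z = ((s'%:Z - s%:Z) %% n%:Z)%Z by rewrite gez0_abs ?modz_ge0.
have lt_dn : (d < n)%N by rewrite -ltz_nat dE ltz_pmod.
have shift z : cyc n_gt0 (s'%:Z + z) = cyc n_gt0 (s%:Z + d%:Z + z).
  apply/val_inj => /=; congr (absz _); rewrite dE -addrA addrCA modzDml.
  by congr (_ %% _)%Z; lia.
exists d; split=> //.
  rewrite leqNgt; apply/negP => lt_dl; apply: (no_common d 0%N lt_dl l'_gt0).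
  by rewrite shift addr0.
rewrite leqNgt; apply/negP => lt_n.
have lt_nd : (n - d < l')%N by lia.
apply: (no_common 0%N (n - d)%N l_gt0 lt_nd); rewrite shift.
have -> : s%:Z + d%:Z + (n - d)%N%:Z = s%:Z + 0%N%:Z + n%:Z by lia.
by rewrite cyc_addn.
Qed.

Theorem corollary4p7 (R : realType) (n : nat) (n_gt0 : (0 < n)%N)
    (G : network R n) (G_planar : circular_planar G)
    (CM_gt0 : forall x y : nat, small_central n x y ->
       0 < CM n_gt0 (response_matrix G) x y) :
  well_connected G.
Proof.
pose m i j := response_matrix G (cyc n_gt0 i) (cyc n_gt0 j).
have m_sym i j : m i j = m j i by rewrite /m response_matrixC.
have m_per i j : m i (j + n%:Z) = m i j by rewrite /m cyc_addn.
have central : central_minors_pos m n.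
  move=> x y x_le y_gt0 y_le; apply: (CM_gt0 x y).
  by rewrite /small_central x_le y_gt0.
have pos := arc_minors_gt0 n_gt0 m_sym m_per central.
move=> A B [s [l [s' [l' [A_sub B_sub disj]]]]] cardAB.
have l_gt0 i : i \in A -> (0 < l)%N.
  by move/(fintype.subsetP A_sub)/(cyclic_intervalP n_gt0) => [t]; case: (l).
have l'_gt0 i : i \in B -> (0 < l')%N.
  by move/(fintype.subsetP B_sub)/(cyclic_intervalP n_gt0) => [t]; case: (l').
have [A0|[i0 i0A]] := set_0Vmem A.
  have B0 : B = finset.set0 by apply/eqP; rewrite -cards_eq0 -cardAB A0 cards0.
  exists id, (fun=> [::]); rewrite A0 B0; split=> [|a|a a']; last 2 first.
  - by rewrite inE.
  - by rewrite inE.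
  - exact: finset.imset0.
have [j0 j0B] : exists j0, j0 \in B.
  apply/finset.set0Pn; rewrite -card_gt0 -cardAB card_gt0.
  by apply/finset.set0Pn; exists i0.
have [d [le_ld le_dn shift]] :=
  disjoint_intervals n_gt0 (l_gt0 _ i0A) (l'_gt0 _ j0B) disj.
(* The last index of the second arc, where the reversed columns begin. *)
pose top : int := s%:Z + d%:Z + l'%:Z - 1.
pose f i j := m (s%:Z + i%:Z) (top - j%:Z).
have f_pos i j k : (i + k <= l)%N -> (j + k <= l')%N ->
    0 < minor f (iota i k) (iota j k).
  move=> le_l le_l'; rewrite minor_iota.
  have -> : top - j%:Z - k%:Z + 1 = s%:Z + i%:Z + (d + l' - j - k - i)%N%:Z.
    by rewrite /top; lia.
  by apply: pos; lia.
pose ga (t : nat) := cyc n_gt0 (s%:Z + t%:Z).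
pose gb (t : nat) := cyc n_gt0 (top - t%:Z).
have ga_inj : {in [pred t | (t < l)%N] &, injective ga}.
  by move=> t u; rewrite !inE => lt_t lt_u /cyc_inj; lia.
have gb_inj : {in [pred t | (t < l')%N] &, injective gb}.
  by move=> t u; rewrite !inE => lt_t lt_u /cyc_inj; lia.
have ga_onto i : i \in A -> exists2 t, (t < l)%N & i = ga t.
  by move/(fintype.subsetP A_sub)/(cyclic_intervalP n_gt0).
have gb_onto i : i \in B -> exists2 t, (t < l')%N & i = gb t.
  move/(fintype.subsetP B_sub)/(cyclic_intervalP n_gt0) => [t lt_t ->].
  exists (l' - 1 - t)%N; first by lia.
  by rewrite shift /gb; congr cyc; rewrite /top; lia.
have [r [r_sorted r_lt szr a_inj aA]] := coordinates ga_inj ga_onto (erefl #|A|).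
have [c [c_sorted c_lt szc b_inj bB]] := coordinates gb_inj gb_onto (esym cardAB).
have rc_gt0 := minor_gt0 f_pos r_sorted c_sorted r_lt c_lt (etrans szr (esym szc)).
rewrite /minor szc in rc_gt0.
have [w w_edge] := det_neq0_perm (det_kirchhoff (lt0r_neq0 rc_gt0)).
rewrite -{1}aA -bB; apply: (disjointly_connected_of_perm a_inj b_inj _ _ (s := w)).
  move=> x y; apply/eqP => xy.
  have xA : ga (nth 0%N r x) \in A.
    by move/setP/(_ (ga (nth 0%N r x))): aA => <-; apply: imset_f.
  have yB : gb (nth 0%N c y) \in B.
    by move/setP/(_ (gb (nth 0%N c y))): bB => <-; apply: imset_f.
  have := disjointFr disj (fintype.subsetP A_sub _ xA).
  by rewrite xy (fintype.subsetP B_sub _ yB).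
by move=> i; have := w_edge i; rewrite mxE.
Qed.
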